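(* Let $a > 3$ and $b > 2$ be real numbers, and let $R = [0,a]\times[0,b]$. Let $t$ be a real number with $0 < t \leq \frac{1}{50}$ and $t < \min\{10(a-3),\, b-2\}$, and let $K_t$ be the closed quadrilateral with vertices, in cyclic order, $$A = \left(2-\tfrac{9}{10}t,\,0\right),\quad B = \left(2+\tfrac{1}{10}t,\,1\right),\quad C = \left(1+\tfrac{1}{10}t,\,1+t\right),\quad D = \left(1-\tfrac{9}{10}t,\,t\right).$$ Then $K_t$ is a square contained in $R$, of side length $\sqrt{1+t^2}$, and the following hold. (a) For every factor $c < 1$ sufficiently close to $1$ (depending on $t$), the image $S$ of $K_t$ under the homothety with ratio $c$ about the center of $K_t$ is a square contained in $R$ whose side length $\lambda$ satisfies $1 < \lambda < \frac{101}{100}$ and whose score satisfies $\sigma(S) < 1$. In particular, the assertion ''$\sigma(S) > 1$ for every square $S \subseteq R$ of side length $\lambda$ with $1 < \lambda \leq \frac{101}{100}$'' is false. (b) For every factor $c < 1$ sufficiently close to $1$ (depending on $t$), the image $S'$ of $K_t$ under the homothety with ratio $c$ about the vertex $A$ has side length greater than $1$, contains $(1,0.9)$ in its interior, and contains $(2,0.9)$ in the relative interior of the edge that is the image of $AB$; moreover the images of $B$ and $D$ lie strictly below the line $y=1$ and the image of $C$ lies strictly above it, so that $y = 1$ cuts the images of the edges $BC$ and $CD$, and the edge containing $(2,0.9)$ is different from both of these.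
   Context: Squares are closed and may have arbitrary orientation. For $a,b > 2$ and $R = [0,a]\times[0,b]$, the score $\sigma$ is defined as follows. Let $$R^* = [1,a-1]\times[1,b-1],$$ $$L_1 = [0.9,a-0.9]\times\{1\},\quad L_2 = [0.9,a-0.9]\times\{b-1\},\quad L_3 = \{1\}\times[0.9,b-0.9],\quad L_4 = \{a-1\}\times[0.9,b-0.9],$$ $$Q = \{(0.9,j),(a-0.9,j): j \in \{1,b-1\}\}\cup\{(i,0.9),(i,b-0.9): i \in \{1,a-1\}\},$$ $$P = \{(i,0.9),(i,b-0.9): i = 2,\ldots,\lceil a\rceil-2\}\cup\{(0.9,j),(a-0.9,j): j = 2,\ldots,\lceil b\rceil-2\},$$ where $i$ and $j$ in the definition of $P$ are integers and an index range is empty when its upper endpoint is less than $2$. The score of a square $S \subseteq R$ is $$\sigma(S) = \operatorname{area}(S\cap R^* )+\frac{1}{2}\sum_{j=1}^{4}\operatorname{length}(S\cap L_j)+\frac{9}{20}\,\#(S\cap Q)+\frac{1}{2}\,\#(S\cap P),$$ where $\operatorname{area}$ is two-dimensional Lebesgue measure, $\operatorname{length}$ is Euclidean length on the segment, and $\#$ denotes cardinality. *)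

(* Defs.v *)
From mathcomp Require Import all_boot all_order all_algebra.
From mathcomp Require Import all_classical all_reals all_analysis.

Set Implicit Arguments.
Unset Strict Implicit.
Unset Printing Implicit Defensive.

Import Order.TTheory GRing.Theory Num.Theory.
Import numFieldNormedType.Exports.

Local Open Scope classical_set_scope.
Local Open Scope ring_scope.

Section Plane.
Context {R : realType}.
Implicit Types (A B C D O p q : R * R) (S X : set (R * R)).

(* The norm that the library puts on R * R is the sup norm, hence this
   separate Euclidean distance. *)
Definition dist p q : R :=
  Num.sqrt ((q.1 - p.1) ^+ 2 + (q.2 - p.2) ^+ 2).

(* Inner product of the vectors from O to p and from O to q. *)
Definition dot_at O p q : R :=
  (p.1 - O.1) * (q.1 - O.1) + (p.2 - O.2) * (q.2 - O.2).

Definition segment A B : set (R * R) :=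
  [set p | exists s : R, [/\ 0 <= s, s <= 1 &
     p = ((1 - s) * A.1 + s * B.1, (1 - s) * A.2 + s * B.2)]].

(* The relative interior of segment A B, when A <> B. *)
Definition open_segment A B : set (R * R) :=
  [set p | exists s : R, [/\ 0 < s, s < 1 &
     p = ((1 - s) * A.1 + s * B.1, (1 - s) * A.2 + s * B.2)]].

(* The convex hull of the vertices; this is the closed region bounded by the
   polygon A B C D when A, B, C, D are in convex position and listed in cyclic
   order, which is the only case in which it is used. *)
Definition quadrilateral A B C D : set (R * R) :=
  [set p | exists w : R * R * R * R,
     let: (w1, w2, w3, w4) := w in
     [/\ [/\ 0 <= w1, 0 <= w2, 0 <= w3 & 0 <= w4],
         w1 + w2 + w3 + w4 = 1 &
         p = (w1 * A.1 + w2 * B.1 + w3 * C.1 + w4 * D.1,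
              w1 * A.2 + w2 * B.2 + w3 * C.2 + w4 * D.2)]].

Definition square_vertices A B C D (l : R) : Prop :=
  [/\ 0 < l,
      [/\ dist A B = l, dist B C = l, dist C D = l & dist D A = l] &
      [/\ dot_at A D B = 0, dot_at B A C = 0,
          dot_at C B D = 0 & dot_at D C A = 0]].

(* S is a closed square, of arbitrary orientation, of side length l. *)
Definition is_square S (l : R) : Prop :=
  exists A B C D, square_vertices A B C D l /\ S = quadrilateral A B C D.

(* The center of a square is the mean of its vertices. *)
Definition square_center A B C D : R * R :=
  ((A.1 + B.1 + C.1 + D.1) / 4, (A.2 + B.2 + C.2 + D.2) / 4).

Definition homothety (c : R) O p : R * R :=
  (O.1 + c * (p.1 - O.1), O.2 + c * (p.2 - O.2)).

Definition rectangle (x0 x1 y0 y1 : R) : set (R * R) :=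
  [set p | [/\ x0 <= p.1, p.1 <= x1, y0 <= p.2 & p.2 <= y1]].

Definition hsegment (x0 x1 y : R) : set (R * R) :=
  [set p | [/\ x0 <= p.1, p.1 <= x1 & p.2 = y]].

Definition vsegment (x y0 y1 : R) : set (R * R) :=
  [set p | [/\ p.1 = x, y0 <= p.2 & p.2 <= y1]].

Definition area X : \bar R :=
  (@lebesgue_measure R \x @lebesgue_measure R)%E X.

(* Length of the part of X on the horizontal line of ordinate y, resp. on the
   vertical line of abscissa x. *)
Definition hlength (y : R) X : \bar R :=
  @lebesgue_measure R [set x | X (x, y)].

Definition vlength (x : R) X : \bar R :=
  @lebesgue_measure R [set y | X (x, y)].

End Plane.

Section Score.
Context {R : realType}.
Variables (a b : R).

Definition board : set (R * R) := rectangle 0 a 0 b.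
Definition inner_board : set (R * R) := rectangle 1 (a - 1) 1 (b - 1).

Definition L1 : set (R * R) := hsegment (9/10) (a - 9/10) 1.
Definition L2 : set (R * R) := hsegment (9/10) (a - 9/10) (b - 1).
Definition L3 : set (R * R) := vsegment 1 (9/10) (b - 9/10).
Definition L4 : set (R * R) := vsegment (a - 1) (9/10) (b - 9/10).

Definition Q : set (R * R) :=
  [set p | exists2 j : R, j = 1 \/ j = b - 1 &
     p = (9/10, j) \/ p = (a - 9/10, j)] `|`
  [set p | exists2 i : R, i = 1 \/ i = a - 1 &
     p = (i, 9/10) \/ p = (i, b - 9/10)].

Definition P : set (R * R) :=
  [set p | exists2 i : int, (2 <= i) && (i <= Num.ceil a - 2) &
     p = (i%:~R, 9/10) \/ p = (i%:~R, b - 9/10)] `|`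
  [set p | exists2 j : int, (2 <= j) && (j <= Num.ceil b - 2) &
     p = (9/10, j%:~R) \/ p = (a - 9/10, j%:~R)].

Definition score (S : set (R * R)) : \bar R :=
  (area (S `&` inner_board)
   + (1/2)%:E * (hlength 1 (S `&` L1) + hlength (b - 1) (S `&` L2)
                 + vlength 1 (S `&` L3) + vlength (a - 1) (S `&` L4))
   + (9/20)%:E * counting (S `&` Q)
   + (1/2)%:E * counting (S `&` P))%E.

End Score.

(* Main.v *)
Require Import Defs.
From mathcomp Require Import all_boot all_order all_algebra.
From mathcomp Require Import all_classical all_reals all_analysis.
From mathcomp Require Import measurable_realfun ring lra.

Import Order.TTheory GRing.Theory Num.Theory.
Import numFieldNormedType.Exports.

Local Open Scope classical_set_scope.
Local Open Scope ring_scope.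

(** The line of [A B] meets y = 9/10 at (2, 9/10), and [C D] meets x = 1 at
   (1, 9/10 + t). Shrinking about the center therefore loses the point
   (2, 9/10) of [P], and every other term is small: the area in the inner board
   is at most t (1 + t/10), the length on [L1] at most 1 + O(t), the length on
   [L3] at most t, and (1, 9/10) is the only point of [Q] that can be hit. The
   score is thus at most 19/20 + O(t), and bounds by boxes are sharp enough for
   t <= 1/50. Shrinking about [A] keeps (2, 9/10) on the edge through [A].
   In both parts 1 - t^2/4 < c < 1 is close enough to 1, because then
   c^2 (1 + t^2) > 1. *)

(** * Half-planes, and bounds for length, area and cardinality *)

Lemma measurable_halfplane (R : realType) (u v w : R) :
  measurable [set p : R * R | 0 <= u * p.1 + v * p.2 + w].
Proof.
have mf : measurable_fun setT (fun p : R * R => u * p.1 + v * p.2 + w).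
  apply: measurable_funD => //; apply: measurable_funD;
    apply: measurable_funM => //.
have := mf measurableT `[0, +oo[%classic (measurable_itv _).
rewrite setTI; congr (measurable _).
by apply/seteqP; split => p /=; rewrite in_itv /= andbT.
Qed.

(** Strict at [x] but weak nearby: the form that places a point in the interior of an intersection
    of closed half-planes. *)
Lemma nbhs_halfplane (R : realType) (u v w : R) (x : R * R) :
  0 < u * x.1 + v * x.2 + w ->
  \forall p \near x, 0 <= u * p.1 + v * p.2 + w.
Proof.
move=> hx.
have cf : (fun p : R * R => u * p.1 + v * p.2 + w) @ x --> u * x.1 + v * x.2 + w.
  apply: cvgD; last exact: cvg_cst.
  by apply: cvgD; apply: cvgM; try exact: cvg_cst; [exact: cvg_fst|exact: cvg_snd].
have hpos : \forall p \near x, 0 < u * p.1 + v * p.2 + w.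
  exact: (cvgr_gt _ cf _ hx).
by apply: filterS hpos => p /ltW.
Qed.

Lemma measurable_rectangle (R : realType) (x0 x1 y0 y1 : R) :
  measurable (rectangle x0 x1 y0 y1).
Proof.
have -> : rectangle x0 x1 y0 y1 = `[x0, x1]%classic `*` `[y0, y1]%classic.
  apply/seteqP; split => p /=; rewrite /rectangle /= !in_itv /=.
    by case=> -> -> -> ->.
  by case=> /andP[-> ->] /andP[-> ->].
by apply: measurableX; exact: measurable_itv.
Qed.

Lemma hsegmentE (R : realType) (x0 x1 y : R) :
  hsegment x0 x1 y = rectangle x0 x1 y y.
Proof.
apply/seteqP; split => -[p q] /=; rewrite /hsegment /rectangle /=.
  by case=> -> -> ->; rewrite lexx.
by case=> -> -> h1 h2; split=> //; apply/eqP; rewrite eq_le h1 h2.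
Qed.

Lemma vsegmentE (R : realType) (x y0 y1 : R) :
  vsegment x y0 y1 = rectangle x x y0 y1.
Proof.
apply/seteqP; split => -[p q] /=; rewrite /vsegment /rectangle /=.
  by case=> -> -> ->; rewrite lexx.
by case=> h1 h2 -> ->; split=> //; apply/eqP; rewrite eq_le h1 h2.
Qed.

Lemma le_lebesgue_itv (R : realType) (X : set R) (x0 x1 : R) :
  x0 <= x1 -> measurable X -> X `<=` `[x0, x1]%classic ->
  (@lebesgue_measure R X <= (x1 - x0)%:E)%E.
Proof.
move=> h01 mX sX.
have -> : (x1 - x0)%:E = @lebesgue_measure R `[x0, x1]%classic.
  (* The measure formula branches on [x0 < x1] and gives 0 otherwise; by [h01] the second branch is
     [x0 = x1], where both sides vanish. *)
  rewrite lebesgue_measure_itv /= lte_fin.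
  case: ifPn => [//|]; rewrite -leNgt => h10.
  by rewrite (@le_anti _ _ x0 x1) ?h01 // subrr.
by apply: le_measure => //; rewrite inE //; exact: measurable_itv.
Qed.

Lemma hlength_le (R : realType) (y x0 x1 : R) (X : set (R * R)) :
  x0 <= x1 -> measurable X -> (forall x, X (x, y) -> x0 <= x <= x1) ->
  (hlength y X <= (x1 - x0)%:E)%E.
Proof.
move=> h01 mX hX; apply: le_lebesgue_itv => //.
have := measurable_ysection y mX; congr (measurable _).
by apply/seteqP; split => x; rewrite /ysection /= inE.
Qed.

Lemma vlength_le (R : realType) (x y0 y1 : R) (X : set (R * R)) :
  y0 <= y1 -> measurable X -> (forall y, X (x, y) -> y0 <= y <= y1) ->
  (vlength x X <= (y1 - y0)%:E)%E.
Proof.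
move=> h01 mX hX; apply: le_lebesgue_itv => //.
have := measurable_xsection x mX; congr (measurable _).
by apply/seteqP; split => y; rewrite /xsection /= inE.
Qed.

Lemma area_le (R : realType) (x0 x1 y0 y1 : R) (X : set (R * R)) :
  x0 <= x1 -> y0 <= y1 -> measurable X -> X `<=` rectangle x0 x1 y0 y1 ->
  (area X <= ((x1 - x0) * (y1 - y0))%:E)%E.
Proof.
move=> hx hy mX sX.
apply: (@le_trans _ _ (area (`[x0, x1]%classic `*` `[y0, y1]%classic))).
  apply: le_measure; rewrite ?inE //.
    by apply: measurableX; exact: measurable_itv.
  by move=> p /sX [h1 h2 h3 h4]; split; rewrite /= in_itv /= ?h1 ?h2 ?h3 ?h4.
rewrite /area product_measure1E; try exact: measurable_itv.
rewrite EFinM; apply: lee_pmul => //; apply: le_lebesgue_itv => //;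
  exact: measurable_itv.
Qed.

Lemma counting_le1 (T : choiceType) (R : realType) (X : set T) (x : T) :
  X `<=` [set x] -> (@counting T R X <= 1)%E.
Proof.
move=> /subset_set1[] ->; rewrite /counting asboolT //.
  by rewrite fset_set0 /= lee_fin.
by rewrite fset_set1 finmap.cardfs1.
Qed.

Lemma counting_set0 (T : choiceType) (R : realType) : @counting T R set0 = 0%E.
Proof. by rewrite /counting asboolT // fset_set0. Qed.

(** * The score bound *)

(** Isolates what the score sees of the shrunken square: a bounding box and its traces on x = 1 and
    y = 9/10. The abscissa 98/100 is a bound free of [t] below that of [D], since 1 - 9t/10 >=
    982/1000. *)
Lemma score_lt1 (R : realType) (a b t : R) (S : set (R * R)) :
  0 < t -> t <= 1/50 -> 3 + t / 10 < a -> 2 + t < b ->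
  measurable S -> S `<=` rectangle (98/100) (2 + t / 10) 0 (1 + t) ->
  (forall y, S (1, y) -> y <= 9/10 + t) ->
  (forall x, S (x, 9/10) -> x < 2) ->
  (score a b S < 1)%E.
Proof.
move=> t0 t1 ha hb mS sS hy hx.
have mI X : measurable X -> measurable (S `&` X) by exact: measurableI.
have harea : (area (S `&` inner_board a b) <= ((1 + t / 10) * t)%:E)%E.
  have -> : (1 + t / 10) * t = ((2 + t / 10) - 1) * ((1 + t) - 1) by ring.
  apply: area_le; [lra|lra|by apply: mI; exact: measurable_rectangle|].
  by move=> p [/sS[_ ? _ ?] [? _ ? _]].
have h1 : (hlength 1 (S `&` L1 a) <= (2 + t / 10 - 98/100)%:E)%E.
  apply: hlength_le; [lra| |by move=> x [/sS[/= -> ->]]].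
  by apply: mI; rewrite /L1 hsegmentE; exact: measurable_rectangle.
have h3 : (vlength 1 (S `&` L3 b) <= t%:E)%E.
  have -> : t = (9/10 + t) - 9/10 by ring.
  apply: vlength_le; [lra| |by move=> y [/hy -> [_ /= ->]]].
  by apply: mI; rewrite /L3 vsegmentE; exact: measurable_rectangle.
have h2 : hlength (b - 1) (S `&` L2 a b) = 0%E.
  rewrite /hlength (_ : mkset _ = set0) ?measure0 //.
  by rewrite -subset0 => x /= [/sS[/= _ _ _]]; lra.
have h4 : vlength (a - 1) (S `&` L4 a b) = 0%E.
  rewrite /vlength (_ : mkset _ = set0) ?measure0 //.
  by rewrite -subset0 => x /= [/sS[/= _ ? _ _]]; lra.
have hQ : (@counting _ R (S `&` Q a b) <= 1)%E.
  apply: (@counting_le1 _ _ _ (1, 9/10)).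
  move=> p [Sp]; have [/= b1 b2 b3 b4] := sS _ Sp.
  (* The box excludes abscissas 9/10, a - 9/10 and a - 1 and the ordinate b - 9/10, which leaves (1,
     9/10). *)
  case=> -[i hi]; case=> e; subst p; move: b1 b2 b3 b4 => /= *.
  - by exfalso; lra.
  - by exfalso; lra.
  - by case: hi => hi; [rewrite hi|exfalso; lra].
  - by exfalso; lra.
have hP : S `&` P a b = set0.
  rewrite -subset0 => p [Sp]; have [/= b1 b2 b3 b4] := sS _ Sp.
  case=> -[i /andP[hi _]]; case=> e; subst p; move: b1 b2 b3 b4 => /= *;
    try by lra.
  (* The box leaves only the points (i, 9/10) with i >= 2, and [hx] excludes these. *)
  have : 2 <= i%:~R :> R by rewrite (_ : 2 = 2%:~R) // ler_int.
  by have := hx _ Sp; lra.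
rewrite /score hP h2 h4 !adde0 counting_set0 mule0 adde0.
(* The sum is 24/25 + 31t/20 + t^2/10, which is below 0.992 for t <= 1/50. *)
have hfin : (((1 + t / 10) * t)%:E
   + (1/2)%:E * ((2 + t / 10 - 98/100)%:E + t%:E) + (9/20)%:E * 1 < 1)%E.
  rewrite mule1 -!(EFinD, EFinM) lte_fin; nra.
apply: le_lt_trans hfin; apply: leeD; first apply: leeD => //.
  by apply: lee_wpmul2l; [rewrite lee_fin; lra|exact: leeD].
by apply: lee_wpmul2l => //; rewrite lee_fin; lra.
Qed.

(** * Convex hulls of four points under homotheties *)

Lemma le_weighted_mean (R : realType) (w1 w2 w3 w4 x a1 a2 a3 a4 : R) :
  [/\ 0 <= w1, 0 <= w2, 0 <= w3 & 0 <= w4] -> w1 + w2 + w3 + w4 = 1 ->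
  [/\ x <= a1, x <= a2, x <= a3 & x <= a4] ->
  x <= w1 * a1 + w2 * a2 + w3 * a3 + w4 * a4.
Proof.
move=> [? ? ? ?] hs [? ? ? ?].
rewrite -[x]mul1r -hs !mulrDl.
by rewrite !lerD // ler_wpM2l.
Qed.

Lemma quadrilateral_sub_rectangle (R : realType) (A B C D : R * R)
    (x0 x1 y0 y1 : R) :
  rectangle x0 x1 y0 y1 A -> rectangle x0 x1 y0 y1 B ->
  rectangle x0 x1 y0 y1 C -> rectangle x0 x1 y0 y1 D ->
  quadrilateral A B C D `<=` rectangle x0 x1 y0 y1.
Proof.
move=> [A1 A2 A3 A4] [B1 B2 B3 B4] [C1 C2 C3 C4] [D1 D2 D3 D4] p.
case=> [[[[w1 w2] w3] w4]] [hw hs ->]; split => /=;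
  (* Upper bounds become lower bounds after negation. *)
  first [exact: le_weighted_mean|rewrite -lerN2 !opprD -!mulrN;
    by apply: le_weighted_mean => //; split; rewrite lerN2].
Qed.

(** Affine maps preserve convex combinations. Eliminating [w1] through the sum of the weights
    reduces this to [ring]. *)
Lemma homothety_quadrilateral (R : realType) (c : R) (O A B C D : R * R) :
  homothety c O @` quadrilateral A B C D =
  quadrilateral (homothety c O A) (homothety c O B)
                (homothety c O C) (homothety c O D).
Proof.
apply/seteqP; split => [q [p [[[[w1 w2] w3] w4]] [hw hs ->] <-]|q];
  last case=> [[[[w1 w2] w3] w4]] [hw hs ->].
  have ? : w1 = 1 - w2 - w3 - w4 by rewrite -hs; ring.
  exists (w1, w2, w3, w4); split => //.
  by subst w1; rewrite /homothety /=; congr pair; ring.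
have ? : w1 = 1 - w2 - w3 - w4 by rewrite -hs; ring.
exists (w1 * A.1 + w2 * B.1 + w3 * C.1 + w4 * D.1,
        w1 * A.2 + w2 * B.2 + w3 * C.2 + w4 * D.2).
  by exists (w1, w2, w3, w4).
by subst w1; rewrite /homothety /=; congr pair; ring.
Qed.

Lemma homothety_segment (R : realType) (c : R) (O A B : R * R) :
  homothety c O @` segment A B = segment (homothety c O A) (homothety c O B).
Proof.
apply/seteqP; split => [q [p [s [s0 s1 ->]] <-]|q [s [s0 s1 ->]]].
  by exists s; split => //; rewrite /homothety /=; congr pair; ring.
exists ((1 - s) * A.1 + s * B.1, (1 - s) * A.2 + s * B.2); first by exists s.
by rewrite /homothety /=; congr pair; ring.
Qed.

(** * Tilted squares as intersections of half-planes *)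

(* The square with a vertex [p] and edge vectors c (t, 1) and c (-1, t) at [p]. *)
Definition tilted_square {R : realType} (p : R * R) (t c : R) : set (R * R) :=
  quadrilateral p (p.1 + c * t, p.2 + c)
    (p.1 + c * (t - 1), p.2 + c * (1 + t)) (p.1 - c, p.2 + c * t).

(** The two linear forms are inner products of q - p with the orthogonal directions (t, 1) and (-1,
    t). Each edge vector pairs to c (1 + t^2) with its own direction and to 0 with the other. *)
Lemma tilted_squareE (R : realType) (p : R * R) (t c : R) : 0 < c ->
  tilted_square p t c =
  [set q | [/\ 0 <= t * (q.1 - p.1) + (q.2 - p.2),
               t * (q.1 - p.1) + (q.2 - p.2) <= c * (1 + t ^+ 2),
               0 <= t * (q.2 - p.2) - (q.1 - p.1) &
               t * (q.2 - p.2) - (q.1 - p.1) <= c * (1 + t ^+ 2)]].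
Proof.
move=> c0; have N0 : 0 < 1 + t ^+ 2 by nra.
have cN0 : 0 < c * (1 + t ^+ 2) by nra.
apply/seteqP; split => [q [[[[w1 w2] w3] w4]] [[? ? ? ?] hs ->]|[x y] /=].
  have ? : w1 = 1 - w2 - w3 - w4 by lra.
  subst w1 => /=.
  have -> : t * ((1 - w2 - w3 - w4) * p.1 + w2 * (p.1 + c * t) +
      w3 * (p.1 + c * (t - 1)) + w4 * (p.1 - c) - p.1) +
      ((1 - w2 - w3 - w4) * p.2 + w2 * (p.2 + c) +
       w3 * (p.2 + c * (1 + t)) + w4 * (p.2 + c * t) - p.2) =
      (w2 + w3) * (c * (1 + t ^+ 2)) by ring.
  have -> : t * ((1 - w2 - w3 - w4) * p.2 + w2 * (p.2 + c) +
       w3 * (p.2 + c * (1 + t)) + w4 * (p.2 + c * t) - p.2) -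
       ((1 - w2 - w3 - w4) * p.1 + w2 * (p.1 + c * t) +
      w3 * (p.1 + c * (t - 1)) + w4 * (p.1 - c) - p.1) =
      (w3 + w4) * (c * (1 + t ^+ 2)) by ring.
  split; first [apply: mulr_ge0; lra|apply: ler_piMl; lra].
set u := t * (x - p.1) + (y - p.2); set v := t * (y - p.2) - (x - p.1).
case=> u0 u1 v0 v1.
(* [m] and [n] are the coordinates of the point in units of the two edges; their bilinear weights
   express it by the four vertices. *)
pose m := u / (c * (1 + t ^+ 2)); pose n := v / (c * (1 + t ^+ 2)).
have m0 : 0 <= m by rewrite divr_ge0 // ltW.
have n0 : 0 <= n by rewrite divr_ge0 // ltW.
have m1 : m <= 1 by rewrite ler_pdivrMr // mul1r.
have n1 : n <= 1 by rewrite ler_pdivrMr // mul1r.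
exists ((1 - m) * (1 - n), m * (1 - n), m * n, (1 - m) * n); split.
- by split; apply: mulr_ge0; rewrite ?subr_ge0.
- by ring.
- congr pair; rewrite /m /n /u /v /=; field;
    by rewrite ?(gt_eqF c0) ?(gt_eqF N0).
Qed.

Lemma tilted_square_is_square (R : realType) (p : R * R) (t c : R) : 0 < c ->
  is_square (tilted_square p t c) (c * Num.sqrt (1 + t ^+ 2)).
Proof.
move=> c0; have N0 : 0 < 1 + t ^+ 2 by nra.
have sqE : c * Num.sqrt (1 + t ^+ 2) = Num.sqrt (c ^+ 2 * (1 + t ^+ 2)).
  by rewrite sqrtrM ?sqr_ge0 // sqrtr_sqr gtr0_norm.
do 4 eexists; split; last reflexivity; split.
- by rewrite mulr_gt0 // sqrtr_gt0.
- by split; rewrite sqE /dist /=; congr Num.sqrt; ring.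
- by split; rewrite /dot_at /=; ring.
Qed.

Lemma homothety_tilted_square (R : realType) (k t c : R) (O p : R * R) :
  homothety k O @` tilted_square p t c =
  tilted_square (homothety k O p) t (k * c).
Proof.
rewrite /tilted_square homothety_quadrilateral /homothety /=.
by congr (quadrilateral _ _ _ _); congr pair; ring.
Qed.

Lemma measurable_tilted_square (R : realType) (p : R * R) (t c : R) : 0 < c ->
  measurable (tilted_square p t c).
Proof.
move=> c0; rewrite tilted_squareE //.
have -> : [set q : R * R | [/\ 0 <= t * (q.1 - p.1) + (q.2 - p.2),
               t * (q.1 - p.1) + (q.2 - p.2) <= c * (1 + t ^+ 2),
               0 <= t * (q.2 - p.2) - (q.1 - p.1) &
               t * (q.2 - p.2) - (q.1 - p.1) <= c * (1 + t ^+ 2)]] =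
  [set q | 0 <= t * q.1 + 1 * q.2 + (- t * p.1 - p.2)] `&`
  [set q | 0 <= - t * q.1 + - 1 * q.2 + (t * p.1 + p.2 + c * (1 + t ^+ 2))] `&`
  [set q | 0 <= - 1 * q.1 + t * q.2 + (p.1 - t * p.2)] `&`
  [set q | 0 <= 1 * q.1 + - t * q.2 + (- p.1 + t * p.2 + c * (1 + t ^+ 2))].
  apply/seteqP; split => q /=; first by case=> *; do ![split]; lra.
  by case=> -[[? ?] ?] ?; split; lra.
do 3 (apply: measurableI; last exact: measurable_halfplane).
exact: measurable_halfplane.
Qed.

Lemma tilted_square_interior (R : realType) (p q : R * R) (t c : R) : 0 < c ->
  0 < t * (q.1 - p.1) + (q.2 - p.2) ->
  t * (q.1 - p.1) + (q.2 - p.2) < c * (1 + t ^+ 2) ->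
  0 < t * (q.2 - p.2) - (q.1 - p.1) ->
  t * (q.2 - p.2) - (q.1 - p.1) < c * (1 + t ^+ 2) ->
  interior (tilted_square p t c) q.
Proof.
move=> c0 h1 h2 h3 h4; rewrite tilted_squareE // /interior.
have n1 : \forall r \near q, 0 <= t * r.1 + 1 * r.2 + (- t * p.1 - p.2).
  by apply: nbhs_halfplane; lra.
have n2 : \forall r \near q,
    0 <= - t * r.1 + - 1 * r.2 + (t * p.1 + p.2 + c * (1 + t ^+ 2)).
  by apply: nbhs_halfplane; lra.
have n3 : \forall r \near q, 0 <= - 1 * r.1 + t * r.2 + (p.1 - t * p.2).
  by apply: nbhs_halfplane; lra.
have n4 : \forall r \near q,
    0 <= 1 * r.1 + - t * r.2 + (- p.1 + t * p.2 + c * (1 + t ^+ 2)).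
  by apply: nbhs_halfplane; lra.
by near=> r; split; [near: r; move: n1|near: r; move: n2|near: r; move: n3|
  near: r; move: n4]; apply: filterS => r; lra.
Unshelve. all: by end_near.
Qed.

(** * The two shrinkings of the square *)

(** With T = t^2, c^2 > 1 - T/2 and (1 - T/2)(1 + T) = 1 + T(1 - T)/2 > 1. Above, 1 + T <= 1.0004 <
    1.01^2. *)
Lemma scaled_side_bounds (R : realType) (t c : R) :
  0 < t -> t <= 1/50 -> 1 - t ^+ 2 / 4 < c -> c < 1 ->
  1 < c * Num.sqrt (1 + t ^+ 2) /\ c * Num.sqrt (1 + t ^+ 2) < 101/100.
Proof.
move=> t0 t1 hc hc1.
have q0 := sqrtr_ge0 (1 + t ^+ 2).
have qq : Num.sqrt (1 + t ^+ 2) ^+ 2 = 1 + t ^+ 2 by rewrite sqr_sqrtr; nra.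
set q := Num.sqrt _ in q0 qq *.
have t2 : 0 < t ^+ 2 by rewrite exprn_gt0.
have t2u : t ^+ 2 <= 1/2500 by nra.
have c2 : 1 < c ^+ 2 * q ^+ 2.
  rewrite qq; set T := t ^+ 2 in t2 t2u hc *.
  have : 1 - T / 2 < c ^+ 2 by nra.
  nra.
split.
  rewrite ltNge; apply/negP => h.
  have : (c * q) ^+ 2 <= 1 by rewrite expr_le1 //; nra.
  by rewrite exprMn; lra.
have : q < 101/100.
  rewrite ltNge; apply/negP => h.
  have : (101/100) ^+ 2 <= q ^+ 2 by rewrite ler_sqr // nnegrE; lra.
  by rewrite qq; lra.
nra.
Qed.
Theorem mainTheorem3 (R : realType) (a b t : R)
  (ha : 3 < a) (hb : 2 < b)
  (ht0 : 0 < t) (ht1 : t <= 1/50)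
  (ht2 : t < Num.min (10 * (a - 3)) (b - 2)) :
  let A : R * R := (2 - 9/10 * t, 0) in
  let B : R * R := (2 + 1/10 * t, 1) in
  let C : R * R := (1 + 1/10 * t, 1 + t) in
  let D : R * R := (1 - 9/10 * t, t) in
  let K := quadrilateral A B C D in
  [/\ is_square K (Num.sqrt (1 + t ^+ 2)) /\ K `<=` board a b,
      (\forall c \near (1 : R)^'-,
         let S := homothety c (square_center A B C D) @` K in
         exists l : R,
           [/\ is_square S l, S `<=` board a b,
               1 < l, l < 101/100 & (score a b S < 1)%E])
      /\ ~ (forall (S : set (R * R)) (l : R),
              is_square S l -> S `<=` board a b ->
              1 < l -> l <= 101/100 -> (1 < score a b S)%E)
    & \forall c \near (1 : R)^'-,
         let h := homothety c A in
         let S' := h @` K in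
         [/\ exists2 l : R, is_square S' l & 1 < l,
             interior S' (1, 9/10),
             open_segment (h A) (h B) (2, 9/10),
             [/\ (h B).2 < 1, (h D).2 < 1 & 1 < (h C).2] &
             [/\ exists2 p, (h @` segment B C) p & p.2 = 1,
                 exists2 p, (h @` segment C D) p & p.2 = 1,
                 h @` segment A B <> h @` segment B C &
                 h @` segment A B <> h @` segment C D]]].

Proof.
move=> A B C D K.
have [hta htb] : t < 10 * (a - 3) /\ t < b - 2 by move: ht2; rewrite lt_min => /andP.
have KE : K = tilted_square A t 1.
  by rewrite /K /tilted_square /A /B /C /D /=; congr (quadrilateral _ _ _ _);
    congr pair => /=; field.
have Kboard : K `<=` rectangle (98/100) (2 + t / 10) 0 (1 + t).
  by apply: quadrilateral_sub_rectangle; split => /=; lra.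
have boardP : rectangle (98/100) (2 + t / 10) 0 (1 + t) `<=` board a b.
  by move=> p [? ? ? ?]; split; lra.
have partA c : 1 - t ^+ 2 / 4 < c -> c < 1 ->
    let S := homothety c (square_center A B C D) @` K in
    exists l : R, [/\ is_square S l, S `<=` board a b,
      1 < l, l < 101/100 & (score a b S < 1)%E].
  move=> hc hc1 S.
  have [l1 l2] := scaled_side_bounds _ _ _ ht0 ht1 hc hc1.
  have c0 : 0 < c by nra.
  set O := square_center A B C D in S *.
  have SE : S = tilted_square (homothety c O A) t c.
    by rewrite /S KE homothety_tilted_square mulr1.
  have Sbox : S `<=` rectangle (98/100) (2 + t / 10) 0 (1 + t).
    rewrite /S homothety_quadrilateral.
    by apply: quadrilateral_sub_rectangle; split;
      rewrite /O /homothety /square_center /=; nra.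
  exists (c * Num.sqrt (1 + t ^+ 2)); split => //.
  - by rewrite SE; exact: tilted_square_is_square.
  - exact: subset_trans Sbox boardP.
  apply: (@score_lt1 _ a b t) => //; try lra.
  - by rewrite SE; exact: measurable_tilted_square.
  (* The fourth inequality is the side [C D]; moving it towards the center lowers its crossing with
     x = 1. *)
  - move=> y; rewrite SE tilted_squareE // => -[_ _ _].
    rewrite /O /homothety /square_center /=; nra.
  (* The third inequality is the side [A B], whose crossing with y = 9/10 moves strictly left of x =
     2 when c < 1. *)
  - move=> x; rewrite SE tilted_squareE // => -[_ _ + _].
    rewrite /O /homothety /square_center /=; nra.
have near1 : \forall c \near (1 : R)^'-, 1 - t ^+ 2 / 4 < c /\ c < 1.
  near=> c; split; near: c; last exact: nbhs_left_lt.
  by apply: nbhs_left_gt; nra.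
split; first split.
- by rewrite KE -[Num.sqrt _]mul1r; exact: tilted_square_is_square.
- exact: subset_trans Kboard boardP.
- split; first by apply: filterS near1 => c [? ?]; exact: partA.
  have [c [c1 c2]] := filter_ex near1.
  have [l [sq bd l1 l2 sc]] := partA c c1 c2.
  move=> /(_ _ _ sq bd l1 (ltW l2)) /(lt_trans sc).
  by rewrite ltxx.
apply: filterS near1 => c [hc hc1].
set h := homothety c A; set S' := h @` K.
have [l1 l2] := scaled_side_bounds _ _ _ ht0 ht1 hc hc1.
(* [c9] puts (2, 9/10) strictly below the image of [B], [cN] puts (1, 9/10) strictly inside the
   image of [C D], and [cT] puts the image of [C] above y = 1. *)
have c9 : 9/10 < c by nra.
have c0 : 0 < c by lra.
have cN : 1 < c * (1 + t ^+ 2) by nra.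
have cT : 1 < c * (1 + t) by nra.
have SE : S' = tilted_square A t c.
  rewrite /S' KE homothety_tilted_square mulr1; congr tilted_square.
  by rewrite /homothety /A /=; congr pair; field.
(* The fixed vertex [A] separates the edges: it has ordinate 0, while the images of [B C] and [C D]
   have positive ordinates. *)
have hAAB : (h @` segment A B) (h A).
  exists A => //; exists 0; split => //; rewrite ?lexx ?ler01 //.
  by rewrite /A /=; congr pair; field.
split.
- exists (c * Num.sqrt (1 + t ^+ 2)) => //.
  by rewrite SE; exact: tilted_square_is_square.
- by rewrite SE; apply: tilted_square_interior; rewrite /A /=; nra.
(* Ordinates on the image of [A B] run from 0 to c. *)
- exists (9/10 / c); split; first by rewrite divr_gt0.
    by rewrite ltr_pdivrMr // mul1r.
  by rewrite /h /homothety /A /B /=; congr pair; field; rewrite gt_eqF.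
- by rewrite /h /homothety /A /B /C /D /=; split; nra.
split.
(* [s] solves c + s c t = 1, the ordinate along the image of [B C]. *)
- rewrite /h homothety_segment -/h; set s := (1 - c) / (c * t).
  exists ((1 - s) * (h B).1 + s * (h C).1, (1 - s) * (h B).2 + s * (h C).2).
    exists s; split => //; first by rewrite divr_ge0 ?mulr_ge0 ?subr_ge0 // ltW.
    by rewrite ler_pdivrMr ?mulr_gt0 // mul1r; lra.
  rewrite /h /homothety /s /=; field.
  by rewrite !gt_eqF.
(* [s] solves c (1 + t) - s c = 1, the ordinate along the image of [C D]. *)
- rewrite /h homothety_segment -/h; set s := 1 + t - c^-1.
  have cV : c^-1 < 1 + t by rewrite -div1r ltr_pdivrMr // mulrC.
  have cV1 : 1 < c^-1 by rewrite -div1r ltr_pdivlMr // mul1r.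
  exists ((1 - s) * (h C).1 + s * (h D).1, (1 - s) * (h C).2 + s * (h D).2).
    exists s; split => //; rewrite /s; last by nra.
    by lra.
  rewrite /h /homothety /s /=; field.
  by rewrite !gt_eqF.
- move=> e; move: hAAB; rewrite e /h homothety_segment => -[s [s0 s1]].
  move=> /(congr1 snd); rewrite /h /homothety /=; nra.
- move=> e; move: hAAB; rewrite e /h homothety_segment => -[s [s0 s1]].
  move=> /(congr1 snd); rewrite /h /homothety /=; nra.
Unshelve. all: by end_near.
Qed.
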